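(* Let $T_1$ and $T_2$ be two tournaments in $\mathcal{T}_H(R)$. Then there exists a sequence of moves consisting of $4$-cycle Hankel switches, pairs consisting of a pure $3$-cycle switch and its complementary $3$-cycle switch in the reverse order, and $3$-cycle Hankel switches, which brings $T_1$ to $T_2$ with all intermediary tournaments (those obtained after each move) in $\mathcal{T}_H(R)$.
   Context: A tournament of order $n$ is an $n\times n$ $(0,1)$-matrix $T=[t_{ij}]$ with $t_{ii}=0$ and $t_{ij}=1-t_{ji}$ for $i\ne j$; its score vector is the vector of its row sums. A Hankel tournament is a tournament with $t_{n+1-j,n+1-i}=t_{ij}$ for all $i,j$; $\mathcal{T}_H(R)$ is the set of Hankel tournaments with score vector $R=(r_1,\ldots,r_n)$. View $T$ as a digraph with an edge $i\rightarrow j$ iff $t_{ij}=1$. The $3$-cycle switch $\triangle_{i,j,k}$ ($i,j,k$ distinct) applies when $i\rightarrow j\rightarrow k\rightarrow i$ is a directed cycle of $T$ and reverses the three edges of this cycle. It is pure if $\{i,j,k\}\cap\{n+1-i,n+1-j,n+1-k\}$ is empty or equal to $\{\frac{n+1}{2}\}$. The complementary switch in the reverse order of $\triangle_{i,j,k}$ is $\triangle^c_{k,j,i}=\triangle_{n+1-k,n+1-j,n+1-i}$. A move of the pair type consists of applying $\triangle_{i,j,k}$ followed by $\triangle^c_{k,j,i}$. A $3$-cycle Hankel switch (only for $n$ odd) is a $3$-cycle switch of the form $\triangle_{i,\frac{n+1}{2},n+1-i}$. A $4$-cycle Hankel switch $\square_{i,j,n+1-j,n+1-i}$ (with $i,j,n+1-j,n+1-i$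 distinct) applies when $i\rightarrow j\rightarrow n+1-j\rightarrow n+1-i\rightarrow i$ is a directed cycle of $T$ and reverses the four edges of this cycle. *)

(* Defs.v *)
From mathcomp Require Import all_boot all_order all_algebra.

Set Implicit Arguments.
Unset Strict Implicit.
Unset Printing Implicit Defensive.

(* Indices 1, ..., n become 'I_n, so that the involution
   i |-> n+1-i is rev_ord, and a (0,1)-matrix is a matrix over bool. *)

Definition is_tournament n (T : 'M[bool]_n) : bool :=
  [forall i, ~~ T i i] && [forall i, forall j, (i != j) ==> (T i j == ~~ T j i)].

Definition score n (T : 'M[bool]_n) : 'rV[nat]_n :=
  (\row_i (\sum_j nat_of_bool (T i j))%N)%R.

Definition is_hankel n (T : 'M[bool]_n) : bool :=
  [forall i, forall j, T (rev_ord j) (rev_ord i) == T i j].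

Definition hankel_tournaments n (R : 'rV[nat]_n) : {set 'M[bool]_n} :=
  [set T | [&& is_tournament T, is_hankel T & score T == R]].

Definition dicycle n (T : 'M[bool]_n) (s : seq 'I_n) : bool :=
  ucycleb (fun i j => T i j) s.

Definition cycle_edge n (s : seq 'I_n) (a b : 'I_n) : bool :=
  (a \in s) && (next s a == b).

(* In a tournament, reversing the edge between a and b exchanges the entries
   (a, b) and (b, a). *)
Definition reverse_cycle n (s : seq 'I_n) (T : 'M[bool]_n) : 'M[bool]_n :=
  (\matrix_(a, b)
     if cycle_edge s a b || cycle_edge s b a then T b a else T a b)%R.

Definition cycle_switch n (s : seq 'I_n) (T T' : 'M[bool]_n) : bool :=
  dicycle T s && (T' == reverse_cycle s T).

(* The 0-based index m stands for m + 1, hence the equation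
   2 (m + 1) = n + 1, which has no solution for n even. *)
Definition is_center n (m : 'I_n) : bool := (2 * m.+1 == n.+1)%N.

Definition pure n (i j k : 'I_n) : bool :=
  let I := [set i; j; k] :&: [set rev_ord i; rev_ord j; rev_ord k] in
  (I == set0) || [exists m, is_center m && (I == [set m])].

Definition pure_pair_move n (T T' : 'M[bool]_n) : bool :=
  [exists i, exists j, exists k, exists U : 'M[bool]_n,
    [&& pure i j k,
        cycle_switch [:: i; j; k] T U &
        cycle_switch [:: rev_ord k; rev_ord j; rev_ord i] U T']].

Definition hankel3_switch n (T T' : 'M[bool]_n) : bool :=
  [exists i, exists m,
    is_center m && cycle_switch [:: i; m; rev_ord i] T T'].

Definition hankel4_switch n (T T' : 'M[bool]_n) : bool :=
  [exists i, exists j,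
    cycle_switch [:: i; j; rev_ord j; rev_ord i] T T'].

Definition hankel_move n (T T' : 'M[bool]_n) : bool :=
  [|| hankel4_switch T T', pure_pair_move T T' | hankel3_switch T T'].

(* Main.v *)
Require Import Defs.
From mathcomp Require Import all_boot all_order all_algebra zify.

Set Implicit Arguments.
Unset Strict Implicit.
Unset Printing Implicit Defensive.

(** Write x' for [rev_ord x] and call an arc a -> b of T1 which T2 orients the
    other way a disagreement.  The proof shows that whenever T1 and T2 differ,
    one move, made on T1 or on T2, brings them closer ([neq_reducible]).  As
    moves are reversible ([hankel_move_sym]), an induction on the distance
    connects T1 to T2.

    The distance counts disagreements, with weight 2 for arcs x -> x' and
    weight 1 for the others.  The weight reflects the symmetry that sends x -> y
    to y' -> x': it fixes the arcs x -> x' and groups the other arcs in pairs, so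
    that every orbit of arcs costs the same.  A move then decreases the distance as
    soon as more than half of the orbits that it reverses are disagreements.

    Suppose that no move decreases the distance.  Then the disagreement relation
    D is closed under a few compositions.  For instance, if a -> b -> d are
    disagreements and a, b, d is pure, then a -> d is one too: if T1 had d -> a,
    reversing a -> b -> d -> a in T1 would help, and if T2 had a -> d, reversing
    d -> b -> a -> d in T2 would help.  The 4-cycle and 3-cycle switches give
    similar rules for the arcs x -> x'.

    These rules have a root system behind them.  With e_(x') = - e_x, the orbit
    of a -> b stands for e_a - e_b, and that of a -> a' for the short root e_a
    (which, if there is a center m = m', has a second copy, the orbit of a -> m):
    a Hankel tournament chooses one of each pair of opposite roots of type B,
    equality of scores says that the disagreeing roots add up to zero, and the
    rules say that the set of disagreements is closed under addition of roots.
    A closed set of roots without opposite elements cannot have sum zero unless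
    it is empty.  In the present language: adding to D the arcs a -> a' for
    which D has a path a -> x -> a' (the roots 2 e_a) makes it a strict order
    ([skew_closed_no_arc]).  If D were not empty, a vertex minimal among those
    with an outgoing disagreement would have no incoming one, whereas equal
    scores provide an incoming one ([disagree_pred]).  Hence D is empty and
    T1 = T2. *)

(** * Tournaments and cycle reversals *)

Lemma tournament_irr n (T : 'M[bool]_n) x : is_tournament T -> T x x = false.
Proof. by case/andP=> /forallP/(_ x)/negbTE. Qed.

Lemma tournament_opp n (T : 'M[bool]_n) x y :
  is_tournament T -> x != y -> T x y = ~~ T y x.
Proof.
by case/andP=> _ /forallP/(_ x)/forallP/(_ y)/implyP h /h /eqP.
Qed.

Lemma tournament_asym n (T : 'M[bool]_n) x y :
  is_tournament T -> T x y -> T y x = false.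
Proof.
move=> tT; have [->|nxy] := eqVneq x y; first by rewrite tournament_irr.
by rewrite (tournament_opp tT nxy) => /negbTE.
Qed.

Lemma is_hankelE n (T : 'M[bool]_n) x y :
  is_hankel T -> T (rev_ord y) (rev_ord x) = T x y.
Proof. by move/forallP/(_ x)/forallP/(_ y)/eqP. Qed.

Lemma is_centerE n (x : 'I_n) : is_center x = (rev_ord x == x).
Proof. by rewrite /is_center -val_eqE /=; have := ltn_ord x; lia. Qed.

Lemma cycle_edge_rev n (s : seq 'I_n) x y :
  uniq s -> cycle_edge (rev s) x y = cycle_edge s y x.
Proof.
move=> us; rewrite /cycle_edge mem_rev next_rev //.
apply/andP/andP=> -[xs /eqP <-].
  by rewrite mem_prev next_prev.
by rewrite mem_next prev_next.
Qed.

Lemma cycle_edge_map n (f : 'I_n -> 'I_n) (s : seq 'I_n) x y :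
  injective f -> uniq s -> cycle_edge (map f s) (f x) (f y) = cycle_edge s x y.
Proof.
by move=> fI us; rewrite /cycle_edge (mem_map fI) next_map // (inj_eq fI).
Qed.

Lemma sum_cycle_edge n (s : seq 'I_n) x (F : 'I_n -> nat) :
  (\sum_y cycle_edge s x y * F y = (x \in s) * F (next s x))%N.
Proof.
rewrite (bigD1 (next s x)) //= /cycle_edge eqxx andbT big1 ?addn0 // => y ny.
by rewrite eq_sym (negbTE ny) andbF.
Qed.

Lemma dicycleP n (T : 'M[bool]_n) (s : seq 'I_n) :
  reflect (uniq s /\ forall x y, cycle_edge s x y -> T x y) (dicycle T s).
Proof.
apply: (iffP andP) => [[cs us]|[us h]]; split=> //.
  by move=> x y /andP[xs /eqP <-]; apply: next_cycle cs xs.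
by apply: cycle_from_next => // x xs; apply: h; rewrite /cycle_edge xs /=.
Qed.

(** Every fact about a reversal used below (scores, symmetry, distance) is read
    off this identity between numbers of arcs, which needs no case analysis on
    the position of x and y in the cycle. *)
Lemma cycle_switch_balance n (T T' : 'M[bool]_n) s x y :
  is_tournament T -> cycle_switch s T T' ->
  (T' x y + cycle_edge s x y = T x y + cycle_edge s y x)%N.
Proof.
move=> tT /andP[/dicycleP[_ h] /eqP->]; rewrite mxE.
case exy: (cycle_edge s x y); case eyx: (cycle_edge s y x) => //=.
- by rewrite (h _ _ exy) (h _ _ eyx).
- by rewrite (h _ _ exy) (tournament_asym tT (h _ _ exy)).
- by rewrite (h _ _ eyx) (tournament_asym tT (h _ _ eyx)).
Qed.

Lemma cycle_switch_arc n (T T' : 'M[bool]_n) s x y :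
  is_tournament T -> cycle_switch s T T' -> T x y -> ~~ cycle_edge s x y ->
  T' x y.
Proof.
move=> tT sw Txy /negbTE nE; have := cycle_switch_balance x y tT sw.
by rewrite Txy nE; case: (T' x y).
Qed.

Lemma cycle_switch_tournament n (T T' : 'M[bool]_n) s :
  is_tournament T -> cycle_switch s T T' -> is_tournament T'.
Proof.
move=> tT /andP[_ /eqP->]; apply/andP; split.
  by apply/forallP=> x; rewrite mxE if_same tournament_irr.
apply/forallP=> x; apply/forallP=> y; apply/implyP=> nxy; rewrite !mxE orbC.
by rewrite (tournament_opp tT nxy) (tournament_opp tT (_ : y != x)) 1?eq_sym //;
   case: ifP; rewrite // negbK.
Qed.

(** Each vertex of the cycle loses the arc to its successor and gains
    the arc to its predecessor. *)
Lemma cycle_switch_score n (T T' : 'M[bool]_n) s :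
  is_tournament T -> cycle_switch s T T' -> score T' = score T.
Proof.
move=> tT sw; have us: uniq s by case/andP: sw => /dicycleP[].
apply/rowP=> x; rewrite !mxE.
have: (\sum_y (T' x y + cycle_edge s x y) =
       \sum_y (T x y + cycle_edge s y x))%N.
  by apply: eq_bigr => y _; apply: cycle_switch_balance.
rewrite !big_split /=.
have deg r : (\sum_y cycle_edge r x y = (x \in r))%N.
  have := sum_cycle_edge r x (fun=> 1%N); rewrite muln1 => <-.
  by apply: eq_bigr => y _; rewrite muln1.
under [X in (_ = _ + X)%N]eq_bigr do rewrite -cycle_edge_rev //.
by rewrite !deg mem_rev => /addIn.
Qed.

Lemma cycle_switch_rev n (T T' : 'M[bool]_n) s :
  is_tournament T -> cycle_switch s T T' -> cycle_switch (rev s) T' T.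
Proof.
move=> tT sw; have bal := cycle_switch_balance _ _ tT sw.
case/andP: sw => /dicycleP[us h] /eqP def; apply/andP; split.
  apply/dicycleP; split=> [|x y]; rewrite ?rev_uniq // cycle_edge_rev //= => e.
  have := bal x y; rewrite e (tournament_asym tT (h _ _ e)).
  case: (cycle_edge s x y) (h x y) (tournament_asym tT (h _ _ e)) => //.
    by move=> /(_ isT)->.
  by case: (T' x y).
apply/eqP/matrixP=> x y; rewrite def !mxE !cycle_edge_rev //.
by case: (cycle_edge s x y); case: (cycle_edge s y x).
Qed.

(** * The three moves *)

(** Image of a directed cycle under x -> y |-> y' -> x'; it has to be read
    backwards to be a directed cycle again. *)
Definition dual n (s : seq 'I_n) := map (@rev_ord n) (rev s).

Lemma cycle_edge_dual n (s : seq 'I_n) x y :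
  uniq s -> cycle_edge (dual s) x y = cycle_edge s (rev_ord y) (rev_ord x).
Proof.
move=> us; rewrite -{1}(rev_ordK x) -{1}(rev_ordK y).
rewrite cycle_edge_map ?rev_uniq ?cycle_edge_rev //; exact: rev_ord_inj.
Qed.

Lemma cycle_switch_hankel n (T T' : 'M[bool]_n) s :
  is_tournament T -> is_hankel T -> dual s = s -> cycle_switch s T T' ->
  is_hankel T'.
Proof.
move=> tT hT ds sw; have us: uniq s by case/andP: sw => /dicycleP[].
have dE x y : cycle_edge s (rev_ord y) (rev_ord x) = cycle_edge s x y.
  by rewrite -cycle_edge_dual // ds.
apply/forallP=> x; apply/forallP=> y.
have := cycle_switch_balance (rev_ord y) (rev_ord x) tT sw.
rewrite !dE (is_hankelE _ _ hT) -(cycle_switch_balance x y tT sw) => /addIn.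
by case: (T' x y); case: (T' (rev_ord y) (rev_ord x)).
Qed.

(** The balance identities of the two reversals add up to one that is
    invariant under duality, so it does not matter whether the two cycles share
    arcs. *)
Lemma dual_pair_hankel n (T U T' : 'M[bool]_n) s :
  is_tournament T -> is_hankel T ->
  cycle_switch s T U -> cycle_switch (dual s) U T' -> is_hankel T'.
Proof.
move=> tT hT sw sw'; have us: uniq s by case/andP: sw => /dicycleP[].
have tU := cycle_switch_tournament tT sw.
apply/forallP=> x; apply/forallP=> y.
have e1 := cycle_switch_balance x y tT sw.
have e2 := cycle_switch_balance x y tU sw'.
have e3 := cycle_switch_balance (rev_ord y) (rev_ord x) tT sw.
have e4 := cycle_switch_balance (rev_ord y) (rev_ord x) tU sw'.
move: e1 e2 e3 e4; rewrite !cycle_edge_dual // !rev_ordK (is_hankelE _ _ hT).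
(* In isolation from the context, where every boolean would be split upon. *)
have solve (t u v w z a b c d : nat) :
    (u + a = t + b -> w + c = u + d -> v + c = t + d -> z + a = v + b ->
     z = w)%N by lia.
move=> e1 e2 e3 e4; move: (solve _ _ _ _ _ _ _ _ _ e1 e2 e3 e4).
by move/(congr1 odd); rewrite !oddb => ->.
Qed.

Lemma hankel_tournamentsP n (R : 'rV[nat]_n) (T : 'M[bool]_n) :
  reflect [/\ is_tournament T, is_hankel T & score T = R]
          (T \in hankel_tournaments R).
Proof. by rewrite inE; apply: (iffP and3P) => -[? ? /eqP]. Qed.

Lemma hankel4_cycle n (i j : 'I_n) :
  dual [:: i; j; rev_ord j; rev_ord i] = [:: i; j; rev_ord j; rev_ord i].
Proof. by rewrite /dual /= !rev_ordK. Qed.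

Lemma hankel3_cycle n (i m : 'I_n) :
  is_center m -> dual [:: i; m; rev_ord i] = [:: i; m; rev_ord i].
Proof. by rewrite is_centerE /dual /= rev_ordK => /eqP->. Qed.

Lemma hankel_move_closed n (R : 'rV[nat]_n) (T T' : 'M[bool]_n) :
  T \in hankel_tournaments R -> hankel_move T T' ->
  T' \in hankel_tournaments R.
Proof.
move=> /hankel_tournamentsP[tT hT <-] mv; apply/hankel_tournamentsP.
case/or3P: mv.
- case/existsP=> i /existsP[j sw]; split.
  + exact: cycle_switch_tournament sw.
  + by apply: cycle_switch_hankel sw; rewrite ?hankel4_cycle.
  + exact: cycle_switch_score sw.
- case/existsP=> i /existsP[j /existsP[k /existsP[U /and3P[_ sw sw']]]].
  have tU := cycle_switch_tournament tT sw; split.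
  + exact: cycle_switch_tournament sw'.
  + exact: dual_pair_hankel sw sw'.
  + by rewrite (cycle_switch_score tU sw') (cycle_switch_score tT sw).
- case/existsP=> i /existsP[m /andP[cm sw]]; split.
  + exact: cycle_switch_tournament sw.
  + by apply: cycle_switch_hankel sw; rewrite ?hankel3_cycle.
  + exact: cycle_switch_score sw.
Qed.

Lemma pure_dual n (i j k : 'I_n) :
  pure i j k -> pure (rev_ord i) (rev_ord j) (rev_ord k).
Proof. by rewrite /pure !rev_ordK [_ :&: [set i; j; k]]setIC. Qed.

(** The cycles are reversed in the opposite order: a move on the pair
    (i, j, k), (k', j', i') is undone by the move on (i', j', k'), (k, j, i). *)
Lemma hankel_move_sym n (T T' : 'M[bool]_n) :
  is_tournament T -> hankel_move T T' -> hankel_move T' T.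
Proof.
move=> tT /or3P[] mv; apply/or3P.
- case/existsP: mv => i /existsP[j /(cycle_switch_rev tT) sw].
  apply: Or31; apply/existsP; exists (rev_ord i).
  by apply/existsP; exists (rev_ord j); rewrite !rev_ordK.
- case/existsP: mv => i /existsP[j /existsP[k /existsP[U /and3P[p sw sw']]]].
  have tU := cycle_switch_tournament tT sw.
  apply: Or32; apply/existsP; exists (rev_ord i); apply/existsP.
  exists (rev_ord j); apply/existsP; exists (rev_ord k).
  apply/existsP; exists U; rewrite pure_dual // !rev_ordK.
  by rewrite (cycle_switch_rev tU sw') (cycle_switch_rev tT sw).
- case/existsP: mv => i /existsP[m /andP[cm /(cycle_switch_rev tT) sw]].
  apply: Or33; apply/existsP; exists (rev_ord i).
  by apply/existsP; exists m; rewrite cm rev_ordK.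
Qed.

(** The three inequalities leave only coincidences x = x' between the two
    triples, and there is at most one fixed point of the symmetry. *)
Lemma pure_distinct n (a b d : 'I_n) :
  b != rev_ord a -> d != rev_ord b -> d != rev_ord a -> pure a b d.
Proof.
have nsym (x y : 'I_n) : y != rev_ord x -> x != rev_ord y.
  by apply: contraNneq => ->; rewrite rev_ordK.
move=> nba ndb nda; rewrite /pure.
set I := (_ :&: _).
have fixI z : z \in I -> rev_ord z = z.
  rewrite !inE -!orbA => /andP[/or3P[]/eqP-> /or3P[]/eqP e]; rewrite -?e //;
  by move: nba ndb nda (nsym _ _ nba) (nsym _ _ ndb) (nsym _ _ nda);
     rewrite -?e ?eqxx.
have [->|/set0Pn[m mI]] := eqVneq I set0; first by [].
apply/orP; right; apply/existsP; exists m.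
rewrite is_centerE fixI // eqxx; apply/eqP/setP=> z.
rewrite in_set1; apply/idP/eqP => [zI|-> //]; apply: val_inj.
have /(congr1 val)/= := fixI z zI; have /(congr1 val)/= := fixI m mI.
by have := ltn_ord z; have := ltn_ord m; lia.
Qed.

(** * A weighted distance between Hankel tournaments *)

Definition arc_weight n (x y : 'I_n) : nat := (1 + (y == rev_ord x))%N.

Definition disagree n (T1 T2 : 'M[bool]_n) (x y : 'I_n) : bool :=
  T1 x y && ~~ T2 x y.

Definition distance n (T1 T2 : 'M[bool]_n) : nat :=
  (\sum_x \sum_y arc_weight x y * disagree T1 T2 x y)%N.

Lemma arc_weight_sym n (x y : 'I_n) : arc_weight x y = arc_weight y x.
Proof. by rewrite /arc_weight eq_sym (can2_eq (@rev_ordK n) (@rev_ordK n)). Qed.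

Lemma arc_weight_rev n (x y : 'I_n) :
  arc_weight (rev_ord y) (rev_ord x) = arc_weight x y.
Proof. by rewrite arc_weight_sym /arc_weight (inj_eq rev_ord_inj). Qed.

Lemma disagree_sym n (T1 T2 : 'M[bool]_n) x y :
  is_tournament T1 -> is_tournament T2 ->
  disagree T1 T2 x y = disagree T2 T1 y x.
Proof.
move=> t1 t2; rewrite /disagree; have [->|nxy] := eqVneq x y.
  by rewrite !tournament_irr.
by rewrite (tournament_opp t1 nxy) (tournament_opp t2 nxy) negbK andbC.
Qed.

Lemma distance_sym n (T1 T2 : 'M[bool]_n) :
  is_tournament T1 -> is_tournament T2 -> distance T1 T2 = distance T2 T1.
Proof.
move=> t1 t2; rewrite /distance exchange_big; apply: eq_bigr => x _.
by apply: eq_bigr => y _; rewrite arc_weight_sym disagree_sym.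
Qed.

(** A reversed arc on which T2 agreed becomes a disagreement, and conversely. *)
Lemma cycle_switch_distance n (T T' T2 : 'M[bool]_n) s :
  is_tournament T -> is_tournament T2 -> cycle_switch s T T' ->
  (distance T' T2 +
     \sum_(x <- s) arc_weight x (next s x) * ~~ T2 x (next s x) =
   distance T T2 +
     \sum_(x <- s) arc_weight x (next s x) * T2 x (next s x))%N.
Proof.
move=> tT t2 sw; have [us arcs] :
    uniq s /\ forall x y, cycle_edge s x y -> T x y.
  by case/andP: sw => /dicycleP.
have sumE (F : 'I_n -> 'I_n -> nat) :
    (\sum_(x <- s) F x (next s x) = \sum_x \sum_y cycle_edge s x y * F x y)%N.
  rewrite big_uniq //= big_mkcond; apply: eq_bigr => x _.
  by rewrite sum_cycle_edge; case: (x \in s); rewrite ?mul1n.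
rewrite (sumE (fun x y => arc_weight x y * ~~ T2 x y)%N).
rewrite (sumE (fun x y => arc_weight x y * T2 x y)%N).
rewrite [X in (_ = _ + X)%N]exchange_big /distance -!big_split /=.
apply: eq_bigr => x _; rewrite -!big_split /=; apply: eq_bigr => y _.
rewrite (arc_weight_sym y x) /disagree.
have := cycle_switch_balance x y tT sw.
case exy: (cycle_edge s x y).
  rewrite (arcs _ _ exy) (_ : cycle_edge s y x = false).
    by case: (T' x y) => //; rewrite mul0n mul1n muln0 addn0.
  by apply: contraFF (tournament_asym tT (arcs _ _ exy)) => /arcs.
case eyx: (cycle_edge s y x); last first.
  by rewrite !addn0; case: (T' x y) (T x y) => [] [].
have Tyx := arcs _ _ eyx; have nxy : x != y.
  by apply: contraTneq Tyx => ->; rewrite tournament_irr.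
rewrite (tournament_asym tT Tyx) (tournament_opp t2 nxy) negbK.
by case: (T' x y) => //; rewrite mul0n mul1n muln0 addn0 add0n.
Qed.

Lemma cycle3_switch_distance n (T T' T2 : 'M[bool]_n) a b d :
  is_tournament T -> is_tournament T2 -> cycle_switch [:: a; b; d] T T' ->
  (distance T' T2 + (arc_weight a b * ~~ T2 a b + arc_weight b d * ~~ T2 b d
                     + arc_weight d a * ~~ T2 d a) =
   distance T T2 + (arc_weight a b * T2 a b + arc_weight b d * T2 b d
                    + arc_weight d a * T2 d a))%N.
Proof.
move=> tT t2 sw; have := cycle_switch_distance tT t2 sw.
case/andP: sw => /dicycleP[/= + _] _; rewrite !inE negb_or -!andbA.
case/and4P=> nab nad nbd _; rewrite !big_cons !big_nil /=.
rewrite !eqxx (eq_sym b a) (eq_sym d a) (eq_sym d b).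
by rewrite (negbTE nab) (negbTE nad) (negbTE nbd) !addn0 !addnA.
Qed.

Lemma cycle4_switch_distance n (T T' T2 : 'M[bool]_n) a b c d :
  is_tournament T -> is_tournament T2 -> cycle_switch [:: a; b; c; d] T T' ->
  (distance T' T2 + (arc_weight a b * ~~ T2 a b + arc_weight b c * ~~ T2 b c
                     + arc_weight c d * ~~ T2 c d + arc_weight d a * ~~ T2 d a)
   = distance T T2 + (arc_weight a b * T2 a b + arc_weight b c * T2 b c
                    + arc_weight c d * T2 c d + arc_weight d a * T2 d a))%N.
Proof.
move=> tT t2 sw; have := cycle_switch_distance tT t2 sw.
case/andP: sw => /dicycleP[/= + _] _; rewrite !inE !negb_or -!andbA.
case/and5P=> nab nac nad nbc /and3P[nbd ncd _]; rewrite !big_cons !big_nil /=.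
rewrite !eqxx (eq_sym b a) (eq_sym c a) (eq_sym d a) (eq_sym c b) (eq_sym d b).
rewrite (eq_sym d c) (negbTE nab) (negbTE nac) (negbTE nad) (negbTE nbc).
by rewrite (negbTE nbd) (negbTE ncd) !addn0 !addnA.
Qed.

Definition reducible n (T T2 : 'M[bool]_n) : bool :=
  [exists T' : 'M[bool]_n,
     hankel_move T T' && (distance T' T2 < distance T T2)%N].

Lemma reverse_cycle_switch n (T : 'M[bool]_n) s :
  dicycle T s -> cycle_switch s T (reverse_cycle s T).
Proof. by rewrite /cycle_switch eqxx andbT. Qed.

Lemma dicycle3 n (T : 'M[bool]_n) a b d :
  is_tournament T -> T a b -> T b d -> T d a -> dicycle T [:: a; b; d].
Proof.
move=> tT ab bd da; rewrite /dicycle /ucycleb /= ab bd da !inE !negb_or /=.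
have neq x y : T x y -> x != y.
  by apply: contraTneq => ->; rewrite tournament_irr.
by rewrite (neq a b) // (neq b d) // eq_sym (neq d a).
Qed.

(** The two cycles have no arc in common because the triple is pure, so the
    reversal of the second one is still possible after the first.  Each of
    them has at least two disagreements out of three arcs, all of weight 1. *)
Lemma pure_pair_reducible n (T T2 : 'M[bool]_n) a b d :
  is_tournament T -> is_hankel T -> is_tournament T2 -> is_hankel T2 ->
  b != rev_ord a -> d != rev_ord b -> d != rev_ord a ->
  T a b -> T b d -> T d a -> ~~ T2 a b -> ~~ T2 b d -> reducible T T2.
Proof.
move=> tT hT t2 h2 nba ndb nda ab bd da n2ab n2bd.
have nab : a != rev_ord b by apply: contraNneq nba => ->; rewrite rev_ordK.
have nbd : b != rev_ord d by apply: contraNneq ndb => ->; rewrite rev_ordK.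
have nad : a != rev_ord d by apply: contraNneq nda => ->; rewrite rev_ordK.
set s := [:: a; b; d]; set U := reverse_cycle s T.
have sw : cycle_switch s T U by apply/reverse_cycle_switch/dicycle3.
have us : uniq s by case/andP: sw => /dicycleP[].
have tU := cycle_switch_tournament tT sw.
have [eab ebd eda] : [/\ next s a = b, next s b = d & next s d = a].
  move: us; rewrite /= !inE negb_or => /and3P[/andP[neab nead] nebd _].
  rewrite !eqxx (eq_sym b a) (eq_sym d a) (eq_sym d b).
  by rewrite (negbTE neab) (negbTE nead) (negbTE nebd).
have dual_arc x y : T x y -> (rev_ord y \in s -> rev_ord y = y) ->
    next s y != rev_ord x -> U (rev_ord y) (rev_ord x).
  move=> Txy fixy ny; apply: cycle_switch_arc tT sw _ _; rewrite ?is_hankelE //.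
  by apply/negP=> /andP[/fixy->]; rewrite (negbTE ny).
have fixs x y : x != rev_ord y -> rev_ord y = x -> rev_ord y = y.
  by move=> /eqP + e; rewrite e.
have dba : U (rev_ord b) (rev_ord a).
  apply: dual_arc; rewrite ?ebd // !inE.
  by case/or3P=> /eqP //; apply: fixs; rewrite // eq_sym.
have ddb : U (rev_ord d) (rev_ord b).
  apply: dual_arc; rewrite ?eda // !inE.
  by case/or3P=> /eqP //; apply: fixs; rewrite // eq_sym.
have dad : U (rev_ord a) (rev_ord d).
  apply: dual_arc; rewrite ?eab // !inE.
  by case/or3P=> /eqP //; apply: fixs; rewrite // eq_sym.
have sw' := reverse_cycle_switch (dicycle3 tU ddb dba dad).
apply/existsP; exists (reverse_cycle [:: rev_ord d; rev_ord b; rev_ord a] U).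
apply/andP; split.
  apply/or3P/Or32; apply/existsP; exists a; apply/existsP; exists b.
  apply/existsP; exists d; apply/existsP; exists U.
  by rewrite pure_distinct // sw.
have := cycle3_switch_distance tT t2 sw.
have := cycle3_switch_distance tU t2 sw'.
rewrite !is_hankelE // !arc_weight_rev (negbTE n2ab) (negbTE n2bd) /arc_weight.
rewrite (negbTE nba) (negbTE ndb) (negbTE nad).
by case: (T2 d a); clear; lia.
Qed.

(** The cycle i -> j -> j' -> i' -> i has three orbits of arcs: that of i -> j,
    of total weight 2, and the two arcs j -> j' and i' -> i, of weight 2 each.
    At least two of the three orbits are disagreements by the last hypothesis. *)
Lemma hankel4_reducible n (T T2 : 'M[bool]_n) i j :
  is_tournament T -> is_hankel T -> is_tournament T2 -> is_hankel T2 ->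
  i != j -> i != rev_ord j ->
  T i j -> T j (rev_ord j) -> T (rev_ord i) i ->
  (T2 i j + T2 j (rev_ord j) + T2 (rev_ord i) i <= 1)%N -> reducible T T2.
Proof.
move=> tT hT t2 h2 nij nij' ij jj' i'i le1.
have nii' : i != rev_ord i.
  by apply: contraTneq i'i => <-; rewrite tournament_irr.
have njj' : j != rev_ord j.
  by apply: contraTneq jj' => <-; rewrite tournament_irr.
set s := [:: i; j; rev_ord j; rev_ord i].
have nj'i : rev_ord i != j by apply: contraNneq nij' => <-; rewrite rev_ordK.
have sw : cycle_switch s T (reverse_cycle s T).
  apply: reverse_cycle_switch; rewrite /dicycle /ucycleb /= ij jj'.
  rewrite is_hankelE // ij i'i !inE !negb_or nij nij' nii' njj' (eq_sym j) nj'i.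
  by rewrite (inj_eq rev_ord_inj) eq_sym nij.
apply/existsP; exists (reverse_cycle s T); apply/andP; split.
  by apply/or3P/Or31; apply/existsP; exists i; apply/existsP; exists j.
have := cycle4_switch_distance tT t2 sw.
rewrite !is_hankelE // !arc_weight_rev /arc_weight rev_ordK !eqxx.
rewrite (eq_sym j) (negbTE nj'i).
by case: (T2 i j) (T2 j _) (T2 _ i) le1 => [] [] [] //= _; clear; lia.
Qed.

Lemma hankel3_reducible n (T T2 : 'M[bool]_n) i m :
  is_tournament T -> is_hankel T -> is_tournament T2 -> is_hankel T2 ->
  is_center m -> T i m -> T (rev_ord i) i -> ~~ T2 i m -> ~~ T2 (rev_ord i) i ->
  reducible T T2.
Proof.
move=> tT hT t2 h2 cm im i'i n2im n2i'i.
have em : rev_ord m = m by apply/eqP; rewrite -is_centerE.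
have mi' : T m (rev_ord i) by rewrite -{1}em is_hankelE.
have n2mi' : ~~ T2 m (rev_ord i) by rewrite -{1}em is_hankelE.
have sw := reverse_cycle_switch (dicycle3 tT im mi' i'i).
apply/existsP; exists (reverse_cycle [:: i; m; rev_ord i] T).
apply/andP; split.
  by apply/or3P/Or33; apply/existsP; exists i; apply/existsP; exists m; apply/andP.
have := cycle3_switch_distance tT t2 sw.
by rewrite (negbTE n2im) (negbTE n2i'i) (negbTE n2mi') /arc_weight; clear; lia.
Qed.

(** * Closed sets of arcs have a source *)

(** The relation E below is the strict order described at the top, and Q a says
    that 2 e_a is a sum of two disagreements.  The delicate part of transitivity
    is a step a -> a' of E that comes from Q a: the closure rules bypass it,
    because D a' d then implies D a d. *)
Lemma skew_closed_no_arc n (D : rel 'I_n) :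
  (forall a b, D a b -> ~~ D b a) ->
  (forall a b, D (rev_ord b) (rev_ord a) = D a b) ->
  (forall a b d, b != rev_ord a -> d != rev_ord b -> d != rev_ord a ->
     D a b -> D b d -> D a d) ->
  (forall a d, D a (rev_ord a) -> D (rev_ord a) d -> D (rev_ord d) d) ->
  (forall a d, D a (rev_ord a) -> D (rev_ord d) d -> D a d) ->
  (forall a b, D a b -> exists x, D x a) ->
  forall a b, ~~ D a b.
Proof.
move=> asym skew triang short_long short_short pred.
have irr a : D a a = false by apply/negP=> Daa; case/negP: (asym _ _ Daa).
have skewl a b : D (rev_ord a) b = D (rev_ord b) a by rewrite -skew rev_ordK.
have skewr a b : D a (rev_ord b) = D b (rev_ord a) by rewrite -skew rev_ordK.
have absurd a b : D a b -> D b a -> False by move/asym/negP.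
have through_short a d : D a (rev_ord a) -> D (rev_ord a) d -> D a d.
  by move=> Daa' Da'd; apply: short_short Daa' (short_long _ _ Daa' Da'd).
pose Q a := [exists x, D a x && D x (rev_ord a)].
pose E a b := D a b || (b == rev_ord a) && Q a.
have Q_nD a : Q a -> ~~ D (rev_ord a) a.
  case/existsP=> x /andP[Dax Dxa']; apply/negP=> Da'a.
  have : D (rev_ord a) x by apply: through_short; rewrite rev_ordK.
  rewrite skewl => Dx'a; apply: (absurd _ _ Dx'a); by rewrite skewr.
have through_Q a d : Q a -> D (rev_ord a) d -> D a d.
  move=> Qa Da'd; have nda : d != a.
    by apply: contraTneq Da'd => ->; apply: Q_nD.
  have nda' : d != rev_ord a by apply: contraTneq Da'd => ->; rewrite irr.
  case/existsP: Qa => x /andP[Dax Dxa'].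
  have ndx' : d != rev_ord x.
    by apply: contraTneq Da'd => ->; rewrite skew; apply: asym.
  have nxa' : x != rev_ord a by apply: contraTneq Dxa' => ->; rewrite irr.
  have nxa : rev_ord a != rev_ord x.
    by rewrite (inj_eq rev_ord_inj); apply: contraTneq Dax => ->; rewrite irr.
  apply: (triang _ _ _ _ _ _ Dax) => //.
  by apply: (triang _ _ _ _ _ _ Dxa' Da'd); rewrite ?rev_ordK.
have Q_not_both a : Q a -> Q (rev_ord a) -> False.
  case/existsP=> x /andP[Dax Dxa'] /existsP[y].
  rewrite rev_ordK => /andP[Da'y Dya].
  have neq u v : D u v -> u != v by apply: contraTneq => ->; rewrite irr.
  have nyx' : y != rev_ord x.
    by apply: contraTneq Da'y => ->; rewrite skew; apply: asym.
  have nxy' : x != rev_ord y by apply: contraNneq nyx' => ->; rewrite rev_ordK.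
  have nay' : a != rev_ord y.
    by apply: contraTneq Da'y => ->; rewrite rev_ordK irr.
  have Dxy : D x y.
    apply: (triang _ _ _ _ _ _ Dxa' Da'y); rewrite ?rev_ordK ?(neq y a) //.
    by rewrite (inj_eq rev_ord_inj) neq.
  by apply: absurd Dxy _; apply: (triang _ _ _ _ _ _ Dya Dax) => //; apply: neq.
have E_trans b a d : E a b -> E b d -> E a d.
  case/orP=> [Dab|/andP[/eqP-> Qa]] /orP[Dbd|/andP[/eqP-> Qb]]; rewrite /E.
  - have [eda|nda] := eqVneq d (rev_ord a).
      by apply/orP; right; apply/existsP; exists b; rewrite Dab -eda.
    rewrite orbF; have [eba|nba] := eqVneq b (rev_ord a).
      by apply: through_short; rewrite -eba.
    have [edb|ndb] := eqVneq d (rev_ord b); last exact: triang Dab Dbd.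
    by rewrite edb skewr through_short ?skew // -edb.
  - by rewrite skewr through_Q ?skew.
  - by rewrite through_Q.
  - by case: (Q_not_both a).
have E_irr a : ~~ E a a.
  (* A loop of E needs a = a' and x with a -> x -> a' = a. *)
rewrite /E irr; apply/negP=> /andP[/eqP e /existsP[x /andP[Dax]]].
  by rewrite -e => /(absurd _ _ Dax).
(* Descent: a predecessor of a has fewer E-predecessors than a. *)
move=> a b; have [k] := ubnP #|[set x | E x a]|.
elim: k a b => // k IHk a b le_k; apply/negP=> /pred[x Dxa].
suff /(IHk x a)/negP : (#|[set z | E z x]| < k)%N by apply.
have Exa : E x a by rewrite /E Dxa.
apply: leq_trans (_ : #|[set z | E z a]| <= k)%N; last by rewrite -ltnS.
apply/proper_card/properP; split.
  by apply/subsetP=> z; rewrite !inE => /E_trans; apply.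
by exists x; rewrite !inE.
Qed.

(** * Some move brings two distinct tournaments closer *)

(** T1 and T2 give a the same out-degree, so an arc out of a in T1 but not in
    T2 is compensated by an arc out of a in T2 but not in T1. *)
Lemma disagree_pred n (T1 T2 : 'M[bool]_n) a b :
  is_tournament T1 -> is_tournament T2 -> score T1 = score T2 ->
  disagree T1 T2 a b -> exists x, disagree T1 T2 x a.
Proof.
move=> t1 t2 sc Dab; apply/existsP; apply: contraT; rewrite negb_exists.
move/forallP=> noD; move/rowP/(_ a): sc; rewrite !mxE => /esym/eqP.
have le12 y : (T2 a y <= T1 a y)%N.
  have := noD y; rewrite disagree_sym // /disagree.
  by case: (T1 a y) (T2 a y) => [] [].
rewrite (bigD1 b) //= [X in _ == X](bigD1 b) //=.
case/andP: Dab => -> /negbTE->; rewrite ltn_eqF // add0n add1n ltnS.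
by apply: leq_sum => y _; apply: le12.
Qed.

(** The disagreements satisfy the closure rules of [skew_closed_no_arc] if no
    move helps, and have no source since the scores are equal. *)
Lemma neq_reducible n (R : 'rV[nat]_n) (T1 T2 : 'M[bool]_n) :
  T1 \in hankel_tournaments R -> T2 \in hankel_tournaments R -> T1 != T2 ->
  reducible T1 T2 || reducible T2 T1.
Proof.
move=> /hankel_tournamentsP[t1 h1 s1] /hankel_tournamentsP[t2 h2 s2].
apply: contraNT; rewrite negb_or => /andP[/negP irr1 /negP irr2].
pose D := disagree T1 T2.
have neg2 x y : ~~ T2 x y -> x != y -> T2 y x.
  by move=> n2 nxy; rewrite (tournament_opp t2) // eq_sym.
have DP a b : D a b -> [/\ T1 a b, ~~ T1 b a, ~~ T2 a b, T2 b a & a != b].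
  move=> /andP[T1ab nT2ab]; rewrite (tournament_asym t1 T1ab).
  have nab : a != b by apply: contraTneq T1ab => ->; rewrite tournament_irr.
  by split=> //; apply: neg2.
have skew a b : D (rev_ord b) (rev_ord a) = D a b.
  by rewrite /D /disagree !is_hankelE.
have asym a b : D a b -> ~~ D b a.
  by move=> /DP[_ nba _ _ _]; rewrite /D /disagree (negbTE nba).
have irr a : D a a = false by rewrite /D /disagree tournament_irr.
(* Each closure rule names an edge {x, y} that completes a reversible cycle
   of T1 if T1 has y -> x, and one of T2 if T2 has x -> y. *)
have force x y : x != y -> (T1 y x -> reducible T1 T2) ->
    (T2 x y -> reducible T2 T1) -> D x y.
  move=> nxy r1 r2; rewrite /D /disagree (tournament_opp t1 nxy).
  by apply/andP; split; [apply/negP=> /r1 | apply/negP=> /r2].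
have D_empty : forall a b, ~~ D a b.
  apply: skew_closed_no_arc => //.
  - move=> a b d nba ndb nda Dab Dbd.
    have [T1ab nT1ba nT2ab T2ba nab] := DP _ _ Dab.
    have [T1bd nT1db nT2bd T2db nbd] := DP _ _ Dbd.
    have nad : a != d.
      by apply: contraTneq Dab => ->; apply: asym.
    apply: force => // [T1da|T2ad].
      exact: (@pure_pair_reducible n T1 T2 a b d).
    have sw (x y : 'I_n) : y != rev_ord x -> x != rev_ord y.
      by apply: contraNneq => ->; rewrite rev_ordK.
    by apply: (@pure_pair_reducible n T2 T1 d b a) => //; apply: sw.
  - move=> a d Daa' Da'd.
    have [T1aa' _ nT2aa' T2a'a naa'] := DP _ _ Daa'.
    have [T1a'd nT1da' nT2a'd T2da' na'd] := DP _ _ Da'd.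
    have nad : a != d.
      by apply: contraTneq Da'd => <-; apply: asym.
    (* For d the center, a' -> d -> a -> a' is a cycle of T1 that T2 reverses
       entirely. *)
    have [cd|nd] := boolP (is_center d).
      case: irr1; apply: (@hankel3_reducible n T1 T2 (rev_ord a) d) => //;
      by rewrite rev_ordK.
    rewrite is_centerE in nd.
    have Dd'a : D (rev_ord d) a by rewrite -skew rev_ordK.
    have [T1d'a _ nT2d'a T2ad' nd'a] := DP _ _ Dd'a.
    apply: force => // [T1dd'|T2d'd].
      apply: (@hankel4_reducible n T1 T2 (rev_ord d) a) => //.
      + by rewrite (inj_eq rev_ord_inj) eq_sym.
      + by rewrite rev_ordK.
      + by rewrite (negbTE nT2d'a) (negbTE nT2aa') leq_b1.
    apply: (@hankel4_reducible n T2 T1 d (rev_ord a)) => //.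
    + by rewrite eq_sym.
    + by rewrite rev_ordK eq_sym.
    + by rewrite rev_ordK.
    + have [_ nT1a'a _ _ _] := DP _ _ Daa'.
      by rewrite rev_ordK (negbTE nT1da') (negbTE nT1a'a) leq_b1.
  - move=> a d Daa' Dd'd.
    have [T1aa' nT1a'a nT2aa' T2a'a naa'] := DP _ _ Daa'.
    have [T1d'd nT1dd' nT2d'd T2dd' nd'd] := DP _ _ Dd'd.
    have nad : a != d.
      by apply: contraTneq Dd'd => <-; apply: asym.
    have [->//|nda'] := eqVneq d (rev_ord a).
    have nad' : a != rev_ord d by apply: contraNneq nda' => ->;
      rewrite rev_ordK.
    apply: force => // [T1da|T2ad].
      apply: (@hankel4_reducible n T1 T2 d a) => //; first by rewrite eq_sym.
      by rewrite (negbTE nT2aa') (negbTE nT2d'd) !addn0 leq_b1.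
    apply: (@hankel4_reducible n T2 T1 a d) => //.
    by rewrite (negbTE nT1dd') (negbTE nT1a'a) !addn0 leq_b1.
  - by move=> a b; apply: disagree_pred; rewrite // s2.
apply/eqP/matrixP=> x y.
have [->|nxy] := eqVneq x y; first by rewrite !tournament_irr.
have := D_empty x y; have := D_empty y x.
rewrite /D /disagree (tournament_opp t1 nxy) (tournament_opp t2 nxy).
by case: (T1 y x) (T2 y x) => [] [].
Qed.

(** A move that helps on the side of T2 is made backwards at the end of the
    path. *)
Lemma hankel_moves_connect n (R : 'rV[nat]_n) (T1 T2 : 'M[bool]_n) :
  T1 \in hankel_tournaments R -> T2 \in hankel_tournaments R ->
  connect [rel T T' | hankel_move T T' && (T' \in hankel_tournaments R)] T1 T2.
Proof.
have [k] := ubnP (distance T1 T2).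
elim: k T1 T2 => // k IHk T1 T2 le_k hT1 hT2.
have [->|n12] := eqVneq T1 T2; first exact: connect0.
have [t1 _ _] := hankel_tournamentsP _ _ hT1.
have [t2 _ _] := hankel_tournamentsP _ _ hT2.
case/orP: (neq_reducible hT1 hT2 n12) => /existsP[T /andP[mv lt]].
  have hT := hankel_move_closed hT1 mv.
  apply: connect_trans (connect1 _) (IHk _ _ (leq_trans lt _) hT hT2) => //=.
  by rewrite mv.
have hT := hankel_move_closed hT2 mv.
have [tT _ _] := hankel_tournamentsP _ _ hT.
apply: connect_trans (IHk _ _ _ hT1 hT) (connect1 _) => /=.
  by rewrite distance_sym // (leq_trans lt) // distance_sym.
by rewrite hankel_move_sym.
Qed.

Theorem theorem15 (n : nat) (R : 'rV[nat]_n) (T1 T2 : 'M[bool]_n)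
    (hT1 : T1 \in hankel_tournaments R) (hT2 : T2 \in hankel_tournaments R) :
  exists s : seq 'M[bool]_n,
    [/\ path (@hankel_move n) T1 s,
        last T1 s = T2 &
        {in s, forall T, T \in hankel_tournaments R}].
Proof.
have /connectP[s ps ->] := hankel_moves_connect hT1 hT2.
exists s; split=> //; first by apply: sub_path ps => T T' /andP[].
elim: s T1 {hT1 hT2} ps => // T s IHs T0 /= /andP[/andP[_ hT] /IHs ih] T'.
by rewrite inE => /predU1P[->|/ih].
Qed.
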